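(* Let $X=\{x_1,x_2\}$ and $Y=\{y_1,y_2\}$ be two-point discrete spaces, and let $\pi_1\colon X\times Y\to X$ and $\pi_2\colon X\times Y\to Y$ be the projections. Then the map $$M_{X,Y}\colon I(X\times Y)\to I(X)\times I(Y),\qquad M_{X,Y}(\mu)=(I(\pi_1)(\mu),I(\pi_2)(\mu)),$$ is not open.
   Context: For a compact Hausdorff space $X$, $C(X)$ is the Banach space of continuous real-valued functions on $X$ with the sup-norm; $c_X\in C(X)$ is the constant function with value $c\in\mathbb R$; $c\odot\varphi=c_X+\varphi$ for $c\in\mathbb R$, $\varphi\in C(X)$, and $\varphi\oplus\psi=\max\{\varphi,\psi\}$ (pointwise); for real numbers $a\odot b=a+b$, $a\oplus b=\max\{a,b\}$. An idempotent probability measure on $X$ is a functional $\mu\colon C(X)\to\mathbb R$ such that $\mu(c_X)=c$, $\mu(c\odot\varphi)=c\odot\mu(\varphi)$ and $\mu(\varphi\oplus\psi)=\mu(\varphi)\oplus\mu(\psi)$ for all $c\in\mathbb R$, $\varphi,\psi\in C(X)$. $I(X)$ is the set of all idempotent probability measures on $X$ with the weak* topology, whose base consists of the sets $\{\nu\in I(X)\mid |\mu(\varphi_i)-\nu(\varphi_i)|<\varepsilon,\ i=1,\dots,n\}$, where $\mu\in I(X)$, $\varphi_1,\dots,\varphi_n\in C(X)$, $\varepsilon>0$. For a continuous map $f\colon X\to Y$ of compact Hausdorff spaces, $I(f)\colon I(X)\to I(Y)$ is defined by $I(f)(\mu)(\varphi)=\mu(\varphi\circ f)$, $\varphi\in C(Y)$.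 A map of topological spaces is open if the image of every open set is open. *)

(* Defs.v *)
From HB Require Import structures.
From mathcomp Require Import all_boot all_order all_algebra.
From mathcomp Require Import all_classical all_reals all_analysis.

Set Implicit Arguments.
Unset Strict Implicit.
Unset Printing Implicit Defensive.

Import Order.TTheory GRing.Theory Num.Theory.
Import numFieldNormedType.Exports.

Local Open Scope classical_set_scope.
Local Open Scope ring_scope.

(* C(X) is the library type [continuousType X R] of continuous maps X -> R.
   Its sup-norm is not needed: neither idempotent measures nor the weak*
   topology on them refer to it. The definitions below make sense for every
   topological space X; the theory concerns compact Hausdorff ones. *)

Section IdempotentMeasures.
Context {R : realType} {X : topologicalType}.
Implicit Types (c : R) (phi psi : continuousType X R).

Lemma continuous_odot c phi : continuous (fun x => c + phi x).
Proof. by move=> x; apply: (@cvgD R R^o); [exact: cvg_cst|exact: (@cts_fun _ _ phi)]. Qed.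

Lemma continuous_oplus phi psi :
  continuous (fun x => Num.max (phi x) (psi x)).
Proof. by move=> x; apply: continuous_max; exact: cts_fun. Qed.

Definition cst_cts c : continuousType X R := cst c.

Definition odot c phi : continuousType X R := mkcts (@continuous_odot c phi).

Definition oplus phi psi : continuousType X R :=
  mkcts (@continuous_oplus phi psi).

Definition is_idempotent_probability (mu : continuousType X R -> R) : Prop :=
  [/\ forall c, mu (cst_cts c) = c,
      forall c phi, mu (odot c phi) = c + mu phi &
      forall phi psi, mu (oplus phi psi) = Num.max (mu phi) (mu psi)].

End IdempotentMeasures.

Record idempotentProbability (R : realType) (X : topologicalType) :=
  IdempotentProbability {
    ipfun :> continuousType X R -> R;
    ipfunP : is_idempotent_probability ipfun }.

HB.instance Definition _ (R : realType) (X : topologicalType) :=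
  gen_eqMixin (idempotentProbability R X).
HB.instance Definition _ (R : realType) (X : topologicalType) :=
  gen_choiceMixin (idempotentProbability R X).

Section WeakStarTopology.
Context {R : realType} {X : topologicalType}.
Local Notation I := (idempotentProbability R X).

Definition weak_star_nbhd (mu : I) (s : seq (continuousType X R)) (e : R) :
    set I :=
  [set nu | forall phi, phi \in s -> `|mu phi - nu phi| < e].

Definition weak_star_base : set (set I) :=
  [set B | exists mu s e, 0 < e /\ B = weak_star_nbhd mu s e].

Lemma weak_star_base_cover : \bigcup_(B in weak_star_base) id B = [set: I].
Proof.
apply/seteqP; split=> // mu _.
exists (weak_star_nbhd mu [::] 1); last by [].
by exists mu, [::], 1.
Qed.

Lemma weak_star_nbhd_center (mu nu : I) s e : weak_star_nbhd mu s e nu ->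
  exists2 d, 0 < d & weak_star_nbhd nu s d `<=` weak_star_nbhd mu s e.
Proof.
elim: s => [|phi s IH] H; first by exists 1.
have [d d0 Hd] : exists2 d, 0 < d &
    weak_star_nbhd nu s d `<=` weak_star_nbhd mu s e.
  by apply: IH => psi psis; apply: H; rewrite inE psis orbT.
have Hphi : `|mu phi - nu phi| < e by apply: H; rewrite mem_head.
exists (Num.min d (e - `|mu phi - nu phi|)).
  by rewrite lt_min d0 subr_gt0.
move=> la Hla psi; rewrite inE => /orP[/eqP->|psis]; last first.
  apply: Hd => // chi chis.
  have /Hla : chi \in phi :: s by rewrite inE chis orbT.
  by rewrite lt_min => /andP[].
have /Hla := mem_head phi s; rewrite lt_min => /andP[_ ld].
rewrite (le_lt_trans (ler_distD (nu phi) _ _))//.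
by rewrite addrC -ltrBrDr.
Qed.

Lemma weak_star_base_join (A B : set I) (nu : I) :
  weak_star_base A -> weak_star_base B -> id A nu -> id B nu ->
  exists C, [/\ weak_star_base C, id C nu & id C `<=` id A `&` id B].
Proof.
move=> [mu1 [s1 [e1 [e10 ->]]]] [mu2 [s2 [e2 [e20 ->]]]].
move=> /weak_star_nbhd_center[d1 d10 H1] /weak_star_nbhd_center[d2 d20 H2].
exists (weak_star_nbhd nu (s1 ++ s2) (Num.min d1 d2)); split.
- exists nu, (s1 ++ s2), (Num.min d1 d2); split=> //.
  by rewrite lt_min d10.
- by move=> phi _; rewrite subrr normr0 lt_min d10.
- move=> la Hla; split.
  + apply: H1 => phi phis.
    have /Hla : phi \in s1 ++ s2 by rewrite mem_cat phis.
    by rewrite lt_min => /andP[].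
  + apply: H2 => phi phis.
    have /Hla : phi \in s1 ++ s2 by rewrite mem_cat phis orbT.
    by rewrite lt_min => /andP[].
Qed.

HB.instance Definition _ := isBaseTopological.Build I
  weak_star_base_cover weak_star_base_join.

End WeakStarTopology.

Section Functoriality.
Context {R : realType} {X Y : topologicalType}.

Definition pushforward_fun (f : continuousType X Y)
    (mu : idempotentProbability R X) : continuousType Y R -> R :=
  fun phi => mu (phi \o f).

Lemma pushforward_subproof (f : continuousType X Y)
    (mu : idempotentProbability R X) :
  is_idempotent_probability (pushforward_fun f mu).
Proof.
have [mu1 mu2 mu3] := ipfunP mu; split => [c|c phi|phi psi].
- by rewrite -[RHS]mu1; congr (ipfun mu _); apply/continuousEP.
- by rewrite -mu2; congr (ipfun mu _); apply/continuousEP.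
- by rewrite -mu3; congr (ipfun mu _); apply/continuousEP.
Qed.

Definition Imap (f : continuousType X Y) (mu : idempotentProbability R X) :
    idempotentProbability R Y :=
  IdempotentProbability (pushforward_subproof f mu).

Lemma continuous_proj1 : continuous (fst : X * Y -> X).
Proof. by move=> p; exact: cvg_fst. Qed.

Lemma continuous_proj2 : continuous (snd : X * Y -> Y).
Proof. by move=> p; exact: cvg_snd. Qed.

Definition proj1_cts : continuousType (X * Y)%type X := mkcts continuous_proj1.
Definition proj2_cts : continuousType (X * Y)%type Y := mkcts continuous_proj2.

End Functoriality.

Definition Mmap (R : realType) (X Y : topologicalType)
    (mu : idempotentProbability R (X * Y)%type) :
    idempotentProbability R X * idempotentProbability R Y :=
  (Imap proj1_cts mu, Imap proj2_cts mu).

Definition open_map (S T : topologicalType) (f : S -> T) : Prop :=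
  forall U : set S, open U -> open (f @` U).

(* Main.v *)
Require Import Defs.
From mathcomp Require Import all_boot all_order all_algebra.
From mathcomp Require Import all_classical all_reals all_analysis.

(** Two-point idempotent measures have the form
    [psi |-> max (psi p) (a + psi q)] with [a <= 0]: weight 0 at [p], weight
    [a] at [q].  Let [mu] put weight 0 on the two diagonal points [(x1, y1)] and
    [(x2, y2)] and no mass elsewhere, so that its marginals carry weight 0 at
    both of their points.  Now lower the weight of the second marginal at [y2]
    from 0 to [- e], and keep the first marginal.  By [dist_two_point] this is a
    small change in the weak* topology.  But in any coupling [nu] of the new
    marginals the mass that [x2] carries with weight 0 can no longer sit at
    [(x2, y2)], where the weight is at most [- e]; it must sit at points
    [(x2, y)] with [y != y2], however small [e] is ([coupling_avoiding]).  These
    points are not charged by [mu], so one test function, the indicator of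
    [{x2} x (Y \ {y2})], separates [mu] from all these [nu]: the
    image of the corresponding neighbourhood of [mu] contains the pair of
    marginals of [mu], but is not a neighbourhood of it. *)

Import Order.TTheory GRing.Theory Num.Theory.
Import numFieldNormedType.Exports.

Local Open Scope ring_scope.
Local Open Scope classical_set_scope.

Section TwoPointMeasure.
Context {R : realType} {X : topologicalType}.
Variables (p q : X) (a : R) (a_le0 : a <= 0).

Definition two_point_fun (psi : continuousType X R) : R :=
  Num.max (psi p) (a + psi q).

Lemma two_point_subproof : is_idempotent_probability two_point_fun.
Proof.
split=> [c|c phi|phi psi]; rewrite /two_point_fun /=.
- by apply/max_idPl; rewrite gerDr.
- by rewrite addrCA addr_maxr.
- by rewrite addr_maxr maxACA.
Qed.

Definition two_point : idempotentProbability R X :=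
  IdempotentProbability two_point_subproof.

Lemma two_pointE psi : two_point psi = Num.max (psi p) (a + psi q).
Proof. by []. Qed.

End TwoPointMeasure.

(** With [u] and [v] the values of a test function at the two points: lowering
    the weight at the second point by [e] changes the measure of every test
    function by at most [e], whatever [u] and [v] are. *)
Lemma dist_two_point {R : realType} (u v e : R) : 0 <= e ->
  `|Num.max u (0 + v) - Num.max u (- e + v)| <= e.
Proof.
move=> e0; rewrite add0r ger0_norm; last first.
  by rewrite subr_ge0 ge_max !le_max lexx gerDr oppr_le0 e0 orbT.
rewrite lerBlDl addr_maxl ge_max !le_max lerDl e0 /=.
by rewrite addrAC addNr add0r lexx orbT.
Qed.

Lemma weak_star_nbhs {R : realType} {X : topologicalType}
    (mu : idempotentProbability R X) (B : set (idempotentProbability R X)) :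
  nbhs mu B ->
  exists s e, 0 < e /\ weak_star_nbhd mu s e `<=` B.
Proof.
rewrite nbhsE => -[_ [[D sD <-]] [A DA Amu]] AB.
have [la [s [e [e0 Aeq]]]] := sD _ DA.
move: Amu; rewrite /= Aeq => /weak_star_nbhd_center[d d0 sub].
exists s, d; split=> // nu /sub nuA; apply: AB; exists A => //.
by rewrite /= Aeq.
Qed.

Lemma open_weak_star_nbhd {R : realType} {X : topologicalType}
    (mu : idempotentProbability R X) s (e : R) :
  0 < e -> open (weak_star_nbhd mu s e).
Proof.
move=> e0; exists [set weak_star_nbhd mu s e]; last by rewrite bigcup_set1.
by move=> _ ->; exists mu, s, e.
Qed.

Section Indicators.
Context {R : realType} {X Y : discreteTopologicalType}.

Lemma continuous_indicator (T : discreteTopologicalType) (P : pred T) :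
  continuous (fun t => (P t)%:R : R).
Proof.
move=> t A /nbhs_singleton At.
by apply: filterS (discrete_set1 t) => _ ->.
Qed.

Definition indicator_cts (T : discreteTopologicalType) (P : pred T) :
    continuousType T R :=
  mkcts (@continuous_indicator T P).

Lemma indicator_ctsE (T : discreteTopologicalType) (P : pred T) t :
  indicator_cts T P t = (P t)%:R.
Proof. by []. Qed.

Lemma continuous_rectangle (P : pred X) (Q : pred Y) :
  continuous (fun z : X * Y => (P z.1 && Q z.2)%:R : R).
Proof.
move=> z A /nbhs_singleton Az.
exists ([set z.1], [set z.2]); first by split; exact: discrete_set1.
by move=> [x y] /= [-> ->].
Qed.

Definition rectangle_cts (P : pred X) (Q : pred Y) :
    continuousType (X * Y)%type R :=
  mkcts (@continuous_rectangle P Q).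

Lemma rectangle_ctsE (P : pred X) (Q : pred Y) x y :
  rectangle_cts P Q (x, y) = (P x && Q y)%:R.
Proof. by []. Qed.

(** The indicators of [{x2} x (Y \ {y2})] and [X x {y2}] dominate together
    that of [{x2} x Y]; since [nu] turns pointwise maxima into maxima, one of
    them has [nu]-value at least 1, and by hypothesis it is not the second. *)
Lemma coupling_avoiding (nu : idempotentProbability R (X * Y)%type)
    (x2 : X) (y2 : Y) :
  1 <= Imap proj1_cts nu (indicator_cts X (pred1 x2)) ->
  Imap proj2_cts nu (indicator_cts Y (pred1 y2)) < 1 ->
  1 <= nu (rectangle_cts (pred1 x2) (predC1 y2)).
Proof.
pose f : continuousType (X * Y)%type R :=
  indicator_cts X (pred1 x2) \o proj1_cts.
pose g : continuousType (X * Y)%type R :=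
  indicator_cts Y (pred1 y2) \o proj2_cts.
set r := rectangle_cts _ _.
move=> f1 g1; have {}f1 : 1 <= nu f := f1; have {}g1 : nu g < 1 := g1.
have [_ _ nuM] := ipfunP nu.
have dom : oplus (oplus r g) f = oplus r g.
  apply/continuousEP => -[x y]; apply/max_idPl.
  have cover : (x == x2)%:R <=
      Num.max ((x == x2) && (y != y2))%:R (y == y2)%:R :> R.
    by case: (x == x2); case: (y == y2); rewrite le_max ?lexx ?ler01 ?orbT.
  exact: cover.
have : 1 <= nu (oplus r g) by rewrite -dom nuM le_max f1 orbT.
by rewrite nuM le_max [X in _ || X]leNgt g1 orbF.
Qed.

End Indicators.

Theorem mainTheorem6 (R : realType) (X Y : discreteTopologicalType)
    (x1 x2 : X) (y1 y2 : Y)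
    (hx : x1 <> x2) (hX : [set: X] = [set x1; x2])
    (hy : y1 <> y2) (hY : [set: Y] = [set y1; y2]) :
  ~ open_map (@Mmap R X Y).
Proof.
pose mu : idempotentProbability R (X * Y)%type :=
  two_point (x1, y1) (x2, y2) 0 (lexx 0).
pose r : continuousType (X * Y)%type R :=
  rectangle_cts (pred1 x2) (predC1 y2).
have mur : mu r = 0.
  rewrite two_pointE !rectangle_ctsE /= !eqxx andbF.
  by move/eqP/negbTE: hx => ->; rewrite add0r maxxx.
move=> /(_ _ (open_weak_star_nbhd mu [:: r] 1 ltr01)) oM.
have : nbhs (Mmap mu) (@Mmap R X Y @` weak_star_nbhd mu [:: r] 1).
  apply: open_nbhs_nbhs; split=> //; exists mu => // phi _.
  by rewrite subrr normr0.
move=> [[A B] /= [nA nB] sub].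
have [s [d [d0 sB]]] := weak_star_nbhs _ _ nB.
pose e : R := d / 2.
have e0 : 0 < e by rewrite divr_gt0.
have ne_le0 : - e <= 0 by rewrite oppr_le0 ltW.
pose beta : idempotentProbability R Y := two_point y1 y2 (- e) ne_le0.
have Bbeta : B beta.
  apply: sB => psi _; apply: (@le_lt_trans _ _ e).
    by apply: dist_two_point; exact: ltW.
  by rewrite ltr_pdivrMr// mulr_natr mulr2n ltrDl.
have /sub[nu + nuM] : (A `*` B) (Imap proj1_cts mu, beta).
  by split=> //; exact: nbhs_singleton.
have [nuX nuY] := (congr1 fst nuM, congr1 snd nuM).
move=> /(_ r (mem_head _ _)); apply/negP; rewrite -leNgt mur sub0r normrN.
apply: le_trans (ler_norm _); apply: coupling_avoiding.
  (* the first marginal of [nu], that of [mu], gives [x2] weight 0 *)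
  have -> : Imap proj1_cts nu (indicator_cts X (pred1 x2)) =
      Num.max (x1 == x2)%:R (0 + (x2 == x2)%:R) by rewrite [Imap _ _]nuX.
  by rewrite eqxx add0r le_max lexx orbT.
(* the second marginal of [nu] gives [y2] weight [- e] *)
rewrite [Imap _ _]nuY two_pointE !indicator_ctsE /= eqxx.
by move/eqP/negbTE: hy => ->; rewrite gt_max ltr01 gtrDr oppr_lt0.
Qed.
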